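(* Let $\mathcal{I}$ be a density ideal on $\omega$. Then the Boolean algebra $\mathcal{A}_{\mathcal{I}^*}=\mathcal{I}\cup\mathcal{I}^*$ has the Nikodym property if and only if $\mathcal{I}$ is isomorphic to an Erdős–Ulam ideal.
   Context: A density submeasure on $\omega$ is $\varphi=\sup_n\mu_n$ where $(\mu_n)$ are finitely supported non-negative measures on $\omega$ with pairwise disjoint supports; a density ideal is $\mathrm{exh}(\varphi)=\{A\subseteq\omega\colon\lim_n\varphi(A\setminus[0,n])=0\}$ for such $\varphi$. $f\colon\omega\to(0,\infty)$ is an Erdős–Ulam function if $\sum_n f(n)=\infty$ and $f(n)/\sum_{i\le n}f(i)\to0$; the associated Erdős–Ulam ideal is $\{A\subseteq\omega\colon\lim_n\sum_{i\in A\cap[0,n)}f(i)/\sum_{i<n}f(i)=0\}$. Ideals $\mathcal{I},\mathcal{J}$ are isomorphic if some bijection $g\colon\omega\to\omega$ satisfies $A\in\mathcal{I}\iff g[A]\in\mathcal{J}$. $\mathcal{I}^*=\{\omega\setminus A\colon A\in\mathcal{I}\}$. A Boolean algebra has the Nikodym property if every sequence of bounded finitely additive real functions on it converging to $0$ at every element is bounded in the variation norm $\|\mu\|=\sup\{|\mu(A)|+|\mu(B)|\colon A\wedge B=0\}$.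
   Formalization: The density ideal is assumed proper (ω ∉ I), as is usual for ideals on ω; for φ = 0 the ideal exh(φ) is all of P(ω), which has the Nikodym property but is not isomorphic to any Erdős–Ulam ideal. *)

(* Defs.v *)
From HB Require Import structures.
From mathcomp Require Import all_boot all_order all_algebra.
From mathcomp Require Import all_classical all_reals all_analysis.

Set Implicit Arguments.
Unset Strict Implicit.
Unset Printing Implicit Defensive.

Import Order.TTheory GRing.Theory Num.Theory.
Import numFieldNormedType.Exports.
Local Open Scope classical_set_scope.
Local Open Scope ring_scope.

Definition msupport (R : realType) (mu : set nat -> \bar R) : set nat :=
  [set k | mu [set k] != 0%E].

Definition density_submeasure (R : realType) (phi : set nat -> \bar R) : Prop :=
  exists mu : nat -> {finite_measure set nat -> \bar R},
    [/\ forall n, finite_set (msupport (mu n)),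
        trivIset setT (fun n => msupport (mu n)) &
        phi = fun A => ereal_sup (range (fun n => mu n A))].

(* [`I_n.+1] is the closed initial segment [0, n]. *)
Definition exh (R : realType) (phi : set nat -> \bar R) : set (set nat) :=
  [set A | phi (A `\` `I_n.+1) @[n --> \oo] --> 0%E].

(* An ideal on omega is proper by convention, whereas [exh phi] may be the    *)
(* whole power set; hence the last conjunct. The other ideal axioms, and the  *)
(* inclusion of the finite sets, are automatic for [exh phi].                 *)
Definition density_ideal (R : realType) (I : set (set nat)) : Prop :=
  exists phi : set nat -> \bar R,
    [/\ density_submeasure phi, I = exh phi & ~ I setT].

Definition erdos_ulam_fun (R : realType) (f : nat -> R) : Prop :=
  [/\ forall n, 0 < f n,
      (\sum_(0 <= i < n) f i) @[n --> \oo] --> +oo &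
      (f n / \sum_(0 <= i < n.+1) f i) @[n --> \oo] --> 0].

Definition erdos_ulam_ideal (R : realType) (f : nat -> R) : set (set nat) :=
  [set A | ((\sum_(0 <= i < n | i \in A) f i) / (\sum_(0 <= i < n) f i))
             @[n --> \oo] --> 0].

Definition ideal_isomorphic (I J : set (set nat)) : Prop :=
  exists2 g : nat -> nat, bijective g & forall A, I A <-> J (g @` A).

Definition dual_filter (I : set (set nat)) : set (set nat) :=
  [set ~` A | A in I].

(* Below, a Boolean algebra is given as an algebra [B] of subsets of [T], and *)
(* a function on [B] as a function on [set T] whose values outside [B] are    *)
(* never used.                                                                *)
Definition finitely_additive (R : realType) (T : Type) (B : set (set T))
    (mu : set T -> R) : Prop :=
  forall X Y, B X -> B Y -> X `&` Y = set0 -> mu (X `|` Y) = mu X + mu Y.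

Definition bounded_on (R : realType) (T : Type) (B : set (set T))
    (mu : set T -> R) : Prop :=
  exists M : R, forall X, B X -> `|mu X| <= M.

Definition variation_norm (R : realType) (T : Type) (B : set (set T))
    (mu : set T -> R) : \bar R :=
  ereal_sup [set z | exists X Y,
    [/\ B X, B Y, X `&` Y = set0 & z = (`|mu X| + `|mu Y|)%:E]].

Definition nikodym (R : realType) (T : Type) (B : set (set T)) : Prop :=
  forall mu : nat -> set T -> R,
    (forall n, finitely_additive B (mu n)) ->
    (forall n, bounded_on B (mu n)) ->
    (forall X, B X -> mu n X @[n --> \oo] --> 0) ->
    exists M : R, forall n, (variation_norm B (mu n) <= M%:E)%E.

(* Main.v *)
(**
  If a submeasure [d] lets every set be cut into two pieces of at most
  half its size, its null sets satisfy a uniform boundedness principle: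
  were a pointwise bounded sequence unbounded on the null sets, one of the
  halves would still carry the unboundedness, so halving repeatedly and
  removing a null set of large value each time yields disjoint null sets
  [B_n], all of whose unions are null, with [mu_(k_n)(B_n)] large; a
  gliding hump along the [B_n] is then a contradiction. The upper density
  of an Erdos-Ulam function is such a submeasure, because sending each
  point to the lighter half keeps the imbalance below the largest weight
  met so far.

  Conversely, a density ideal consists of the [A] with [W_n(A)] tending to
  [0], for measures [W_n] living on disjoint finite blocks that cover
  [nat]. Subtracting from [W_n] its total mass times the two-valued
  measure of the dual filter gives a sequence tending to [0] on the
  algebra, so the Nikodym property bounds the masses of the [W_n]; the
  same trick with multiples of point masses makes the point weights tend
  to [0]. As [I] is proper, infinitely many masses exceed some [c > 0]:
  renumber the blocks, leaving gaps, so that these are the even ones.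
  Listing the points block after block, with the weights of block [j]
  multiplied by [2 ^ j], produces the Erdos-Ulam function: its densities
  are comparable to the dyadic means of the [W_j(A)], which tend to [0]
  exactly when the [W_j(A)] do.
*)

Require Import Defs.
From mathcomp Require Import all_boot all_order all_algebra.
From mathcomp Require Import all_classical all_reals all_analysis.
From mathcomp Require Import lra zify.

Set Implicit Arguments.
Unset Strict Implicit.
Unset Printing Implicit Defensive.

Import Order.TTheory GRing.Theory Num.Theory.
Import numFieldNormedType.Exports.
Local Open Scope classical_set_scope.
Local Open Scope ring_scope.

(** * The gliding hump *)

Lemma infinite_range (T : Type) (f : nat -> T) :
  injective f -> infinite_set (range f).
Proof.
move=> finj; have /eq_finite_set -> : (range f #= [set: nat])%card.
  by apply: inj_card_eq => m n _ _ /finj.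
exact: infinite_nat.
Qed.

Lemma infinite_set_split (T : Type) (X : set T) : infinite_set X ->
  exists Y, [/\ Y `<=` X, infinite_set Y & infinite_set (X `\` Y)].
Proof.
elim/Ppointed: T => T in X *; first by rewrite emptyE => /(_ (finite_set0 _)).
move=> /infiniteP/pcard_leP[f].
have fX n : X (f n) by exact: funS.
have finj : injective f by move=> m n; apply: inj; rewrite in_setT.
have even_inj : injective (fun n => f n.*2) by move=> m n /finj/double_inj.
have odd_inj : injective (fun n => f n.*2.+1) by move=> m n /finj[]/double_inj.
exists (range (fun n => f n.*2)); split; first by move=> _ [n _ <-].
  exact: infinite_range even_inj.
apply: sub_infinite_set (infinite_range odd_inj) => _ [n _ <-]; split=> //.
by case=> m _ /finj/(congr1 odd); rewrite /= !odd_double.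
Qed.

Lemma dependent_choice_inv (T : Type) (inv : T -> Prop)
    (step : nat -> T -> T -> Prop) (x0 : T) : inv x0 ->
  (forall n x, inv x -> exists2 y, inv y & step n x y) ->
  exists x : nat -> T,
    x 0%N = x0 /\ forall n, inv (x n) /\ step n (x n) (x n.+1).
Proof.
move=> inv0 next.
pose R (s t : nat * {x | inv x}) :=
  t.1 = s.1.+1 /\ step s.1 (sval s.2) (sval t.2).
have nextR s : {t | R s t}.
  apply: cid; case: s => n [x invx]; have [y invy xy] := next n x invx.
  by exists (n.+1, exist _ y invy).
have [s [s0 sS]] := dependent_choice nextR (0%N, exist _ x0 inv0).
have s_index n : (s n).1 = n by elim: n => [|n IH]; rewrite ?s0// (sS n).1 IH.
exists (fun n => sval (s n).2); split=> [|n]; first by rewrite s0.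
by split; [exact: proj2_sig|rewrite -[n in step n]s_index; exact: (sS n).2].
Qed.

Section boundedness.
Context (R : realType) (T : Type).
Implicit Types (B : set (set T)) (mu : nat -> set T -> R).

Definition pointwise_bounded_on B mu : Prop :=
  forall X, B X -> exists M, forall k, `|mu k X| <= M.

Definition uniformly_bounded_on B mu : Prop :=
  exists M, forall k X, B X -> `|mu k X| <= M.

Definition boundedness_property B : Prop := forall mu,
  (forall k, finitely_additive B (mu k)) -> (forall k, bounded_on B (mu k)) ->
  pointwise_bounded_on B mu -> uniformly_bounded_on B mu.

End boundedness.

Section gliding_hump.
Context (R : realType).
Implicit Types (nu : set nat -> R) (X F : set nat).

Lemma infinite_subset_le1 nu X : finitely_additive setT nu ->
  bounded_on setT nu -> infinite_set X ->
  exists Y, [/\ Y `<=` X, infinite_set Y & forall Z, Z `<=` Y -> nu Z <= 1].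
Proof.
move=> addnu [M Mnu] infX; apply: contrapT => noY.
have nu0 : nu set0 = 0.
  by have := addnu set0 set0 I I (setI0 _); rewrite setU0; lra.
have large n : forall Y, Y `<=` X -> infinite_set Y ->
    exists2 Z, Z `<=` Y & n%:R <= nu Z.
  elim: n => [|n IH] Y YX infY; first by exists set0 => //; rewrite nu0.
  have [Y' [Y'Y infY' infD]] := infinite_set_split infY.
  have [Z ZY' nuZ] : exists2 Z, Z `<=` Y' & 1 < nu Z.
    apply: contrapT => noZ; apply: noY; exists Y'.
    split=> // [x /Y'Y/YX //|Z ZY'].
    by rewrite leNgt; apply/negP => nuZ; apply: noZ; exists Z.
  have [W WD nuW] := IH (Y `\` Y') (fun x Dx => YX x Dx.1) infD.
  exists (Z `|` W); first by move=> x [/ZY'/Y'Y|/WD[]].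
  rewrite addnu//; first by rewrite -natr1; lra.
  by apply/seteqP; split=> // x [/ZY' Y'x /WD[_]].
have [Z _ nuZ] := large (Num.truncn M).+1 X (@subset_refl _ _) infX.
have := truncnS_gt M; have := ler_norm (nu Z); have := Mnu Z I; lra.
Qed.

Lemma infinite_subset_norm_le1 nu X : finitely_additive setT nu ->
  bounded_on setT nu -> infinite_set X ->
  exists Y, [/\ Y `<=` X, infinite_set Y & forall Z, Z `<=` Y -> `|nu Z| <= 1].
Proof.
move=> addnu [M Mnu] infX.
have [Y [YX infY nuY]] :=
  infinite_subset_le1 addnu (ex_intro _ M Mnu) infX.
have addN : finitely_additive setT (fun Z => - nu Z).
  by move=> Z W _ _ ZW; rewrite addnu// opprD.
have bndN : bounded_on setT (fun Z => - nu Z).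
  by exists M => Z _; rewrite normrN Mnu.
have [Z [ZY infZ nuZ]] := infinite_subset_le1 addN bndN infY.
exists Z; split=> // [x /ZY/YX //|W WZ].
have := nuY W (subset_trans WZ ZY); have := nuZ W WZ; rewrite ler_norml; lra.
Qed.

Context (nu : nat -> set nat -> R).
Hypothesis nu_additive : forall k, finitely_additive setT (nu k).
Hypothesis nu_bounded : forall k, bounded_on setT (nu k).
Hypothesis nu_pointwise_bounded : pointwise_bounded_on setT nu.

(* The first component holds the points chosen so far, the second one those   *)
(* still available.                                                           *)
Definition hump (n : nat) (FX GY : set nat * set nat) : Prop := exists i,
  [/\ FX.2 i, GY.1 = i |` FX.1, GY.2 `<=` FX.2 `\ i,
    `|nu i FX.1| + n%:R + 1 < `|nu i [set i]| &
    forall Z, Z `<=` GY.2 -> `|nu i Z| <= 1].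

Lemma hump_exists (n : nat) (FX : set nat * set nat) :
  `|nu i [set i]| @[i --> \oo] --> +oo ->
  infinite_set FX.2 -> exists2 GY, infinite_set GY.2 & hump n FX GY.
Proof.
case: FX => F X /= nuy infX.
have [M FM] := nu_pointwise_bounded (X := F) I.
have /cvgryPgt/(_ (M + n%:R + 1))[N _ nu_large] := nuy.
have [i [Xi /negP]] := infinite_setN0 (infinite_setD infX (finite_II N)).
rewrite -leqNgt => Ni.
have infXi := infinite_setD infX (finite_set1 i).
have [Y [YX infY nuY]] :=
  infinite_subset_norm_le1 (nu_additive i) (nu_bounded i) infXi.
exists (i |` F, Y) => //; exists i; split=> //=.
by have := nu_large i Ni; have := FM i => /=; lra.
Qed.

Lemma hump_homo (s : nat -> set nat * set nat) :
  (forall n, hump n (s n) (s n.+1)) ->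
  {homo s : m n / (m <= n)%N >->
    [/\ m.1 `<=` n.1, n.1 `<=` m.1 `|` m.2 & n.2 `<=` m.2]}.
Proof.
move=> s_hump; apply: homo_leq => [p|p q r [qp pqX pX] [rp qrX qX]|n].
- by split=> // x; left.
- split; [exact: subset_trans rp| |exact: subset_trans pX].
  by move=> x /qrX[/pqX //|/pX]; right.
have [i [Xi -> YX _ _]] := s_hump n; split=> [x|x [->|]|x /YX[]//].
- by right.
- by right.
- by left.
Qed.

Lemma gliding_hump : ~ (`|nu i [set i]| @[i --> \oo] --> +oo).
Proof.
move=> nuy.
have [s [s0 /all_and2[_ s_hump]]] := dependent_choice_inv (x0 := (set0, setT))
  (inv := fun FX => infinite_set FX.2) infinite_nat
  (fun n FX => @hump_exists n FX nuy).
pose F n := (s n).1; pose X n := (s n).2.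
have extends := hump_homo s_hump.
have XF n : X n `&` F n = set0.
  elim: n => [|n IH]; first by rewrite /F s0 /= setI0.
  have [i [Xi FE YX _ _]] := s_hump n.
  apply/seteqP; split=> // x [/YX[Xx xi]].
  by rewrite /F FE => -[//|Fx]; rewrite -IH.
have [M nuM] := nu_pointwise_bounded (X := \bigcup_n F n) I.
pose n := (Num.truncn M).+1.
have [i [Xi FE _ nui nuX]] := s_hump n.
have nuF : nu i (F n.+1) = nu i [set i] + nu i (F n).
  rewrite /F FE nu_additive//; apply/seteqP; split=> // x [/= -> Fi].
  by have : (X n `&` F n) i by []; rewrite XF.
have FX m : F m `<=` F n.+1 `|` X n.+1.
  have [/extends[FmF _ _] x /FmF|/ltnW/extends[_ FmF _] //] := leqP m n.+1.
  by left.
have /nuX tail : \bigcup_n F n `\` F n.+1 `<=` X n.+1.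
  by move=> x [[m _ /FX[]]].
have := nuM i; rewrite -(setDUK (bigcup_sup (F := F) (i := n.+1) I)).
rewrite nu_additive ?setDIK// nuF.
have := ler_normB (nu i [set i] + nu i (F n)) (nu i (F n)).
have := ler_normB (nu i (F n.+1) + nu i (\bigcup_n F n `\` F n.+1))
  (nu i (\bigcup_n F n `\` F n.+1)).
rewrite !addrK nuF; have := truncnS_gt M; rewrite -/n; lra.
Qed.

End gliding_hump.

Lemma cvg_norm_bounded (R : realType) (u : nat -> R) (l : R) :
  u n @[n --> \oo] --> l -> exists M, forall n, `|u n| <= M.
Proof.
move=> /cvgP/cvg_seq_bounded[M [_ uM]].
by exists (M + 1) => n; apply: uM => //; rewrite ltrDl.
Qed.

Lemma squeeze_cvg0 (R : realFieldType) (T : Type) (F : set_system T)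
    {FF : Filter F} (u v : T -> R) :
  (\forall t \near F, 0 <= u t <= v t) -> v t @[t --> F] --> 0 ->
  u t @[t --> F] --> 0.
Proof. by move=> uv; apply: (squeeze_cvgr uv); exact: cvg_cst. Qed.

Lemma boundedness_nikodym (R : realType) (I : set (set nat)) :
  I set0 -> boundedness_property R I -> nikodym R (I `|` dual_filter I).
Proof.
move=> I0 bdd mu mu_add mu_bdd mu_cvg0.
have IIT : (I `|` dual_filter I) setT by right; exists set0; rewrite ?setC0.
have [M muM] : uniformly_bounded_on I mu.
  apply: bdd => [k X Y IX IY|k|X IX].
  - by apply: mu_add; left.
  - by have [M muM] := mu_bdd k; exists M => X IX; apply: muM; left.
  - by apply: (@cvg_norm_bounded _ _ 0); apply: mu_cvg0; left.
have [MT muT] := cvg_norm_bounded (mu_cvg0 _ IIT).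
have muB k X : (I `|` dual_filter I) X -> `|mu k X| <= M + MT.
  have MT0 : 0 <= MT by apply: le_trans (normr_ge0 _) (muT 0%N).
  case=> [IX|[A IA <-]]; first by have := muM k X IX; lra.
  have -> : mu k (~` A) = mu k setT - mu k A.
    rewrite -(setUv A) mu_add ?setICr//; [lra|by left|by right; exists A].
  by apply: le_trans (ler_normB _ _) _; rewrite addrC lerD ?muM.
exists ((M + MT) + (M + MT)) => k.
apply: ge_ereal_sup => _ [X [Y [BX BY _ ->]]].
by rewrite lee_fin lerD ?muB.
Qed.

(** * Uniform boundedness on the null sets of a halvable submeasure *)

Section submeasure.
Context (R : realType) (T : Type).
Implicit Types (d : set T -> R) (A B P Q : set T).

Definition submeasure d : Prop :=
  [/\ d set0 = 0, forall A B, A `<=` B -> d A <= d B &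
      forall A B, d (A `|` B) <= d A + d B].

Definition null_ideal d : set (set T) := [set A | d A = 0].

Definition halvable d : Prop := forall P, exists Q,
  [/\ Q `<=` P, d Q <= d P / 2 & d (P `\` Q) <= d P / 2].

Lemma submeasure_ge0 d A : submeasure d -> 0 <= d A.
Proof. by case=> <- dS _; exact: dS. Qed.

Lemma null_ideal0 d : submeasure d -> null_ideal d set0.
Proof. by case. Qed.

Lemma null_idealS d A B :
  submeasure d -> A `<=` B -> null_ideal d B -> null_ideal d A.
Proof.
move=> subd AB dB; apply/eqP; rewrite eq_le submeasure_ge0// andbT -dB.
by case: subd => _ dS _; exact: dS.
Qed.

Lemma null_idealU d A B :
  submeasure d -> null_ideal d A -> null_ideal d B -> null_ideal d (A `|` B).
Proof.
move=> subd dA dB; apply/eqP; rewrite eq_le submeasure_ge0// andbT.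
by case: subd => _ _ /(_ A B); rewrite dA dB addr0.
Qed.

Lemma null_ideal_bigcup d (P B : nat -> set T) (J : set nat) :
  submeasure d -> (forall n, null_ideal d (B n)) -> (forall n, B n `<=` P n) ->
  {homo P : m n / (m <= n)%N >-> n `<=` m} -> d (P n) @[n --> \oo] --> 0 ->
  null_ideal d (\bigcup_(n in J) B n).
Proof.
move=> subd dB BP Pmono dP; apply/eqP; rewrite eq_le submeasure_ge0// andbT.
have [_ dS dU] := subd; apply: (cvgr_to_ge dP); apply: nearW => m.
pose F := \big[setU/set0]_(j < m) B j.
have dF : d F = 0.
  apply: (big_ind (null_ideal d)) => //; first exact: null_ideal0.
  by move=> X Y; exact: null_idealU.
have BF : \bigcup_(n in J) B n `<=` F `|` P m.
  move=> x [n _ Bx]; have [nm|mn] := ltnP n m.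
    by left; rewrite /F -bigcup_mkord; exists n.
  by right; apply: Pmono mn _ _; exact: BP.
by apply: le_trans (dS _ _ BF) _; have := dU F (P m); rewrite dF add0r.
Qed.

End submeasure.

Section halvable_boundedness.
Context (R : realType) (T : Type) (d : set T -> R).
Hypotheses (subd : submeasure d) (halved : halvable d).
Context (mu : nat -> set T -> R).
Hypothesis mu_additive : forall k, finitely_additive (null_ideal d) (mu k).
Hypothesis mu_pointwise_bounded : pointwise_bounded_on (null_ideal d) mu.

Definition unbounded_within (P : set T) : Prop := forall C,
  exists k B, [/\ null_ideal d B, B `<=` P & C < `|mu k B|].

Lemma unbounded_withinS P Q :
  P `<=` Q -> unbounded_within P -> unbounded_within Q.
Proof.
move=> PQ unbP C; have [k [B [dB BP CB]]] := unbP C.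
by exists k, B; split=> //; exact: subset_trans PQ.
Qed.

Lemma unbounded_within_split P Q : unbounded_within P ->
  unbounded_within (P `&` Q) \/ unbounded_within (P `\` Q).
Proof.
move=> unbP; apply: contrapT => /not_orP[/existsNP[C nI] /existsNP[D nD]].
have [k [B [dB BP]]] := unbP (C + D); apply/negP; rewrite -leNgt.
have dBI : null_ideal d (B `&` Q) by apply: null_idealS dB => // x [].
have dBD : null_ideal d (B `\` Q) by apply: null_idealS dB => // x [].
rewrite -(setUIDK B Q) mu_additive//; last first.
  by apply/seteqP; split=> // x [[_ ?] [_]].
apply: le_trans (ler_normD _ _) _; apply: lerD; rewrite leNgt; apply/negP => CB.
  by apply: nI; exists k, (B `&` Q); split=> //; exact: setSI.
by apply: nD; exists k, (B `\` Q); split=> //; exact: setSD.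
Qed.

Lemma unbounded_within_half P : unbounded_within P ->
  exists Q, [/\ Q `<=` P, unbounded_within Q & d Q <= d P / 2].
Proof.
have [Q [QP dQ dPQ]] := halved P.
move=> /unbounded_within_split-/(_ Q)[]; rewrite ?(setIidr QP) => unb.
  by exists Q.
by exists (P `\` Q); split=> // x [].
Qed.

(* If removing [B] destroys the unboundedness, then [B] carries it; a subset  *)
(* [D] of [B] with a large value then splits [B] into two sets with large     *)
(* values, one of which can be removed.                                       *)
Lemma unbounded_within_setD P C : unbounded_within P -> exists k B,
  [/\ null_ideal d B, B `<=` P, C < `|mu k B| & unbounded_within (P `\` B)].
Proof.
move=> unbP; have [k [B [dB BP CB]]] := unbP C.
have [] := unbounded_within_split B unbP; last by exists k, B.
rewrite (setIidr BP) => unbB; have [M muB] := mu_pointwise_bounded dB.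
have [l [D [dD DB CD]]] := unbB (C + M).
have dBD : null_ideal d (B `\` D) by apply: null_idealS dB => // x [].
have large : C < `|mu l D| /\ C < `|mu l (B `\` D)|.
  have := muB l; rewrite -{1}(setDUK DB) mu_additive ?setDIK// => muB_l.
  have := ler_normB (mu l D + mu l (B `\` D)) (mu l (B `\` D)).
  have := normr_ge0 (mu l D + mu l (B `\` D)); rewrite addrK; lra.
have [] := unbounded_within_split D unbB; rewrite ?(setIidr DB) => unb.
  exists l, (B `\` D); split=> //; [by move=> x [/BP]|exact: large.2|].
  by apply: unbounded_withinS unb => x Dx; split; [exact/BP/DB|case].
exists l, D; split=> //; [exact: subset_trans BP|exact: large.1|].
by apply: unbounded_withinS unb => x [/BP].
Qed.

Lemma unbounded_within_hump P C : unbounded_within P ->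
  exists k B Q, [/\ null_ideal d B, B `<=` P, C < `|mu k B|,
    unbounded_within Q & [/\ Q `<=` P, B `&` Q = set0 & d Q <= d P / 2]].
Proof.
move=> /unbounded_within_half[Q [QP unbQ dQ]].
have [k [B [dB BQ CB unb]]] := unbounded_within_setD C unbQ.
exists k, B, (Q `\` B); split=> //; first exact: subset_trans QP.
split=> [x [/QP]//||]; first by rewrite setDIK.
by apply: le_trans dQ; case: subd => _ dS _; apply: dS => x [].
Qed.

Lemma unbounded_within_humps : unbounded_within setT ->
  exists (k : nat -> nat) (B : nat -> set T),
    [/\ trivIset setT B, forall J, null_ideal d (\bigcup_(n in J) B n) &
      forall n, n%:R < `|mu (k n) (B n)|].
Proof.
move=> unbT.
have [|P [_ P_step]] := dependent_choice_inv (inv := unbounded_within)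
  (step := fun n P Q => exists k B,
    [/\ null_ideal d B, B `<=` P, n%:R < `|mu k B| &
      [/\ Q `<=` P, B `&` Q = set0 & d Q <= d P / 2]]) unbT.
  move=> n P /(unbounded_within_hump n%:R)[k [B [Q [dB BP CB unbQ QP]]]].
  by exists Q => //; exists k, B.
have /choice[k /choice[B B_hump]] n := (P_step n).2.
have Pmono : {homo P : m n / (m <= n)%N >-> n `<=` m}.
  apply: homo_leq => [Q x //|Q Q1 Q2 QQ1 QQ2|n]; first exact: subset_trans QQ1.
  by have [_ _ _ []] := B_hump n.
have dP n : d (P n) <= d (P 0%N) / 2 ^+ n.
  elim: n => [|n IH]; first by rewrite expr0 divr1.
  have [_ _ _ [_ _ dP_half]] := B_hump n; rewrite exprS invfM mulrCA mulrC.
  by apply: le_trans dP_half _; rewrite ler_pM2r// invr_gt0.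
have dP0 : d (P n) @[n --> \oo] --> 0.
  apply: (squeeze_cvg0 (v := geometric (d (P 0%N)) 2^-1)).
    by apply: nearW => n; rewrite /= submeasure_ge0//= exprVn dP.
  by apply: cvg_geometric; rewrite ger0_norm; lra.
exists k, B; split=> [|J|n]; last by have [] := B_hump n.
  apply: ltn_trivIset => m n nm; apply/seteqP; split=> // x [Bm Bn].
  have [_ _ _ [_ BPn _]] := B_hump n; rewrite -BPn; split=> //.
  by apply: Pmono nm _ _; have [_ BP _ _] := B_hump m; exact: BP.
by apply: (null_ideal_bigcup (P := P)) => // n; have [] := B_hump n.
Qed.

End halvable_boundedness.

Lemma halvable_boundedness (R : realType) (T : Type) (d : set T -> R) :
  submeasure d -> halvable d -> boundedness_property R (null_ideal d).
Proof.
move=> subd halved mu mu_add mu_bdd mu_pbdd; apply: contrapT => unb.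
have unbT : unbounded_within d mu setT.
  move=> C; apply: contrapT => small; apply: unb; exists C => k X dX.
  by rewrite leNgt; apply/negP => large; apply: small; exists k, X.
have [k [B [trivB dB large]]] :=
  unbounded_within_humps subd halved mu_add mu_pbdd unbT.
apply: (@gliding_hump _ (fun i J => mu (k i) (\bigcup_(j in J) B j))).
- move=> i X Y _ _ XY; rewrite bigcup_setU mu_add//.
  apply/seteqP; split=> // x [[m Xm Bm] [n Yn Bn]].
  have mn : m = n by apply: trivB => //; exists x.
  by have : (X `&` Y) m; [split=> //; rewrite mn|rewrite XY].
- by move=> i; have [M muM] := mu_bdd (k i); exists M => X _; exact: muM.
- by move=> X _; have [M muM] := mu_pbdd _ (dB X); exists M => i; exact: muM.
- apply: (ger_cvgy (f := fun i => i%:R)); last exact: cvgr_idn.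
  by apply: nearW => i; rewrite bigcup_set1 ltW.
Qed.

(** * Erdos-Ulam ideals have the Nikodym property *)

Lemma limn_sup_leP (R : realType) (u : nat -> R) (l : R) : bounded_fun u ->
  limn_sup u <= l <-> forall e, l < e -> \forall n \near \oo, u n <= e.
Proof.
move=> ub; have ubound N := has_ubound_sdrop (bounded_fun_has_ubound ub) N.
have inf_sups : has_inf (range (sups u)).
  split; first by exists (sups u 0%N); exists 0%N.
  exact: bounded_fun_has_lbound_sups.
rewrite limn_supE//; split=> [ule e l_lt_e|ue].
  have [_ [N _ <-] sups_lt] := inf_lt inf_sups.1 (le_lt_trans ule l_lt_e).
  exists N => // n Nn; apply: le_trans (ltW sups_lt).
  by apply: ub_le_sup => //; exists n.
apply/ler_addgt0Pr => e e0.
have [|N _ uN] := ue (l + e); first by rewrite ltrDl.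
apply: (@le_trans _ _ (sups u N)).
  by apply: ge_inf; [exact: inf_sups.2|exists N].
by apply: ge_sup => [|_ [n Nn <-]]; [exists (u N), N => /= | exact: uN].
Qed.

Section upper_density.
Context (R : realType) (f : nat -> R).
Implicit Types (A B : set nat) (n : nat).

Definition partial_sum A n : R := \sum_(0 <= i < n | i \in A) f i.

Definition total_sum n : R := \sum_(0 <= i < n) f i.

Definition partial_density A n : R := partial_sum A n / total_sum n.

Definition upper_density A : R := limn_sup (partial_density A).

Lemma partial_sumT n : partial_sum setT n = total_sum n.
Proof. by apply: eq_bigl => i; rewrite in_setT. Qed.

Lemma partial_sum0 n : partial_sum set0 n = 0.
Proof. by apply: big_pred0 => i; rewrite in_set0. Qed.

Lemma partial_sumS A n :
  partial_sum A n.+1 = partial_sum A n + (if n \in A then f n else 0).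
Proof. by rewrite /partial_sum big_mkcond big_nat_recr//= -big_mkcond. Qed.

Lemma partial_sum_fsbig A n : partial_sum A n = \sum_(x \in A `&` `I_n) f x.
Proof.
by rewrite /partial_sum big_mkcond big_mkord fsbig_mkcondl -fsbig_ord.
Qed.

Lemma partial_sumU A B n : A `&` B = set0 ->
  partial_sum (A `|` B) n = partial_sum A n + partial_sum B n.
Proof.
move=> AB; rewrite !partial_sum_fsbig setIUl fsbigU0//.
- exact/finite_setIr/finite_II.
- exact/finite_setIr/finite_II.
- by move=> x [[Ax _] [Bx _]]; rewrite -AB.
Qed.

Hypothesis f_gt0 : forall n, 0 < f n.

Lemma partial_sum_ge0 A n : 0 <= partial_sum A n.
Proof. by apply: sumr_ge0 => i _; exact: ltW. Qed.

Lemma le_partial_sum A B m n :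
  A `<=` B -> (m <= n)%N -> partial_sum A m <= partial_sum B n.
Proof.
move=> AB mn; apply: (@le_trans _ _ (partial_sum B m)).
  rewrite -(setDUK AB) partial_sumU ?setDIK//.
  by rewrite lerDl partial_sum_ge0.
rewrite /partial_sum (big_cat_nat (leq0n m) mn)//= lerDl.
by apply: sumr_ge0 => i _; exact: ltW.
Qed.

Lemma le_total_sum m n : (m <= n)%N -> total_sum m <= total_sum n.
Proof. by move=> mn; rewrite -!partial_sumT le_partial_sum. Qed.

Lemma total_sum_ge0 n : 0 <= total_sum n.
Proof. by rewrite -partial_sumT partial_sum_ge0. Qed.

Lemma total_sumS_gt0 n : 0 < total_sum n.+1.
Proof. by rewrite /total_sum big_nat_recr//= ltr_wpDl// total_sum_ge0. Qed.

Lemma partial_density_ge0 A n : 0 <= partial_density A n.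
Proof. by rewrite divr_ge0 ?partial_sum_ge0 ?total_sum_ge0. Qed.

Lemma le_partial_density A B n :
  A `<=` B -> partial_density A n <= partial_density B n.
Proof.
by move=> AB; rewrite ler_wpM2r ?invr_ge0 ?total_sum_ge0// le_partial_sum.
Qed.

Lemma partial_densityU A B n : A `&` B = set0 ->
  partial_density (A `|` B) n = partial_density A n + partial_density B n.
Proof. by move=> AB; rewrite /partial_density partial_sumU// mulrDl. Qed.

Lemma partial_density_le1 A n : partial_density A n <= 1.
Proof.
case: n => [|n]; first by rewrite /partial_density /partial_sum big_nil mul0r.
rewrite ler_pdivrMr ?total_sumS_gt0// mul1r -partial_sumT.
exact: le_partial_sum.
Qed.

Lemma upper_density_leP A l : upper_density A <= l <->
  forall e, l < e -> \forall n \near \oo, partial_density A n <= e.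
Proof.
apply: limn_sup_leP; exists 1; split=> // M M1 n _ /=.
rewrite ger0_norm ?partial_density_ge0//.
exact: le_trans (partial_density_le1 _ _) (ltW M1).
Qed.

Lemma upper_density_cvg A l :
  partial_density A n @[n --> \oo] --> l -> upper_density A = l.
Proof. by move=> /cvg_limn_inf_sup[]. Qed.

Lemma near_partial_density_le A e : 0 < e ->
  \forall n \near \oo, partial_density A n <= upper_density A + e.
Proof.
by move=> e0; apply: (upper_density_leP A _).1 (lexx _) _ _; rewrite ltrDl.
Qed.

Lemma submeasure_upper_density : submeasure upper_density.
Proof.
split=> [|A B AB|A B].
- apply: upper_density_cvg; rewrite /partial_density.
  by under eq_fun do rewrite partial_sum0 mul0r; exact: cvg_cst.
- apply/upper_density_leP => e /(upper_density_leP B _).1-/(_ (lexx _)).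
  by apply: filterS => n; apply: le_trans; exact: le_partial_density.
apply/upper_density_leP => e; rewrite -subr_gt0 => e0.
have e2_gt0 := divr_gt0 e0 (ltr0Sn R 1).
apply: filterS2 (near_partial_density_le A e2_gt0)
  (near_partial_density_le B e2_gt0) => n.
have -> : A `|` B = A `|` (B `\` A) by rewrite setDE setUIr setUv setIT.
rewrite partial_densityU ?setDIK//.
have := @le_partial_density (B `\` A) B n (fun x => @proj1 _ _); lra.
Qed.

Lemma null_ideal_upper_density : null_ideal upper_density = erdos_ulam_ideal f.
Proof.
apply/seteqP; split=> A; last exact: upper_density_cvg.
move=> /= dA; apply/cvgr0Pnorm_le => e e0.
have /upper_density_leP/(_ e e0) : upper_density A <= 0 by rewrite dA.
by apply: filterS => n; rewrite ger0_norm// partial_density_ge0.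
Qed.

End upper_density.

Section erdos_ulam_halving.
Context (R : realType) (f : nat -> R).
Hypothesis EUf : erdos_ulam_fun f.

Let f_gt0 n : 0 < f n. Proof. by case: EUf. Qed.

Lemma near_le_total_sum e : 0 < e ->
  \forall n \near \oo, f n <= e * total_sum f n.+1.
Proof.
case: EUf => _ _ /cvgr0Pnorm_le fo e0; apply: filterS (fo e e0) => n.
by rewrite -ler_pdivrMr ?total_sumS_gt0//; apply: le_trans; exact: ler_norm.
Qed.

Lemma near_total_sum_ge C : \forall n \near \oo, C <= total_sum f n.
Proof. by case: EUf => _ /cvgryPge. Qed.

Lemma div_total_sum_cvg0 (v : nat -> R) :
  (forall n, `|v n.+1| <= Num.max `|v n| (f n)) ->
  v n / total_sum f n @[n --> \oo] --> 0.
Proof.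
move=> v_step; apply/cvgr0Pnorm_le => e e0.
have [N _ fN] := near_le_total_sum e0.
have vN n : (N <= n)%N -> `|v n| <= Num.max `|v N| (e * total_sum f n).
  elim: n => [|n IH]; first by rewrite leqn0 => /eqP ->; rewrite le_max lexx.
  rewrite leq_eqVlt ltnS => /predU1P[<-|Nn]; first by rewrite le_max lexx.
  apply: le_trans (v_step n) _; rewrite ge_max !le_max fN// orbT andbT.
  have := IH Nn; rewrite le_max => /orP[->//|v_le].
  apply/orP; right; apply: le_trans v_le _.
  by rewrite ler_wpM2l ?(ltW e0)// le_total_sum.
near=> n; have total_gt0 : 0 < total_sum f n.
  by apply: lt_le_trans ltr01 _; near: n; exact: near_total_sum_ge.
rewrite normrM normfV (gtr0_norm total_gt0) ler_pdivrMr//.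
apply: le_trans (vN n _) _; first by near: n; exact: nbhs_infty_ge.
rewrite ge_max lexx andbT mulrC -ler_pdivrMr//; near: n.
exact: near_total_sum_ge.
Unshelve. all: by end_near. Qed.

(* Each point of [P] joins the lighter of the two halves; the value is the    *)
(* weight of the first half minus that of the second.                         *)
Fixpoint greedy_balance (P : set nat) (n : nat) : R :=
  if n is m.+1 then
    let D := greedy_balance P m in
    if m \in P then if 0 <= D then D - f m else D + f m else D
  else 0.

Definition greedy_half (P : set nat) : set nat :=
  [set n | P n /\ greedy_balance P n < 0].

Lemma greedy_half_sub P : greedy_half P `<=` P.
Proof. by move=> n []. Qed.

Lemma partial_sum_greedy_half P n :
  partial_sum f (greedy_half P) n =
    (partial_sum f P n + greedy_balance P n) / 2.
Proof.
elim: n => [|n IH]; first by rewrite /partial_sum !big_nil add0r mul0r.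
rewrite !partial_sumS IH /=; have [Pn|Pn] := boolP (n \in P); last first.
  by rewrite ifF ?addr0//; apply: contraNF Pn => /set_mem[/mem_set].
have [Dn|Dn] := leP 0 (greedy_balance P n).
  by rewrite ifF; [lra|apply/negP => /set_mem[_]; rewrite ltNge Dn].
by rewrite ifT; [lra|apply/mem_set; split=> //; exact/set_mem].
Qed.

Lemma greedy_balance_step P n :
  `|greedy_balance P n.+1| <= Num.max `|greedy_balance P n| (f n).
Proof.
have /= := f_gt0 n; move: (f n) => x x0; rewrite le_max.
case: ifP => _; last by rewrite lexx.
have [Dn|Dn] := leP 0 (greedy_balance P n).
  have [x_le|x_gt] := leP x (greedy_balance P n); apply/orP; [left|right].
    by rewrite ler_norml ger0_norm//; lra.
  by rewrite ler_norml; lra.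
have [x_le|x_gt] := leP x (- greedy_balance P n); apply/orP; [left|right].
  by rewrite ler_norml ltr0_norm//; lra.
by rewrite ler_norml; lra.
Qed.

Lemma upper_density_half P Q (v : nat -> R) :
  (forall n, partial_sum f Q n = (partial_sum f P n + v n) / 2) ->
  v n / total_sum f n @[n --> \oo] --> 0 ->
  upper_density f Q <= upper_density f P / 2.
Proof.
move=> QP /cvgr0Pnorm_le v0; apply/upper_density_leP => // e.
rewrite -subr_gt0 => e0.
apply: filterS2 (near_partial_density_le f_gt0 P e0) (v0 _ e0) => n.
rewrite {2}/partial_density QP ler_norml mulrAC mulrDl.
rewrite -/(partial_density _ _ _); lra.
Qed.

Lemma upper_density_halvable : halvable (upper_density f).
Proof.
move=> P; exists (greedy_half P); have sub := @greedy_half_sub P.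
have D0 := div_total_sum_cvg0 (greedy_balance_step P).
split=> //; first exact: upper_density_half (partial_sum_greedy_half P) D0.
apply: (upper_density_half (v := fun n => - greedy_balance P n)) => [n|].
  have := partial_sumU f n (setDIK (greedy_half P) P).
  by rewrite setDUK// partial_sum_greedy_half; lra.
by rewrite -oppr0; under eq_fun do rewrite mulNr; exact: cvgN.
Qed.

Lemma erdos_ulam_nikodym :
  nikodym R (erdos_ulam_ideal f `|` dual_filter (erdos_ulam_ideal f)).
Proof.
rewrite -null_ideal_upper_density//.
have subd := submeasure_upper_density f_gt0.
apply: boundedness_nikodym; first exact: null_ideal0.
exact: halvable_boundedness upper_density_halvable.
Qed.

End erdos_ulam_halving.

Lemma ideal_isomorphic_nikodym (R : realType) (I J : set (set nat)) :
  ideal_isomorphic I J -> nikodym R (J `|` dual_filter J) ->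
  nikodym R (I `|` dual_filter I).
Proof.
move=> [g [h gK hK] gI] nikJ mu mu_add mu_bdd mu0.
have imE A : g @` A = h @^-1` A.
  apply/seteqP; split=> [_ [x Ax <-]|y hy]; first by rewrite /= gK.
  by exists (h y).
have ghK A : g @^-1` (h @^-1` A) = A by apply/seteqP; split=> x /=; rewrite gK.
have hgK A : h @^-1` (g @^-1` A) = A by apply/seteqP; split=> x /=; rewrite hK.
have IJ A : I A <-> J (h @^-1` A) by rewrite -imE.
have g_alg A : (J `|` dual_filter J) A -> (I `|` dual_filter I) (g @^-1` A).
  case=> [JA|[X JX <-]]; [left|right; exists (g @^-1` X) => //].
    by apply/IJ; rewrite hgK.
  by apply/IJ; rewrite hgK.
have h_alg A : (I `|` dual_filter I) A -> (J `|` dual_filter J) (h @^-1` A).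
  by case=> [/IJ|[X /IJ JX <-]]; [left|right; exists (h @^-1` X)].
have [||X /g_alg BX|M muM] := nikJ (fun n X => mu n (g @^-1` X)).
- move=> n X Y /g_alg BX /g_alg BY XY.
  by rewrite preimage_setU mu_add// -preimage_setI XY.
- by move=> n; have [M muM] := mu_bdd n; exists M => X /g_alg; exact: muM.
- exact: mu0.
exists M => n; apply: le_trans (muM n).
apply: ge_ereal_sup => _ [X [Y [BX BY XY ->]]].
apply: ereal_sup_ubound; exists (h @^-1` X), (h @^-1` Y).
by split; [exact: h_alg|exact: h_alg|rewrite -preimage_setI XY|rewrite !ghK].
Qed.

(** * Block ideals *)

Lemma finite_set_near_sub (A : set nat) :
  finite_set A -> \forall n \near \oo, A `<=` `I_n.
Proof.
move=> /finite_seqP[s ->]; exists (\max_(x <- s) x).+1 => // n /= sn x xs /=.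
by apply: leq_trans sn; rewrite ltnS leq_bigmax_seq.
Qed.

Lemma finite_set_near_notin (A : set nat) :
  finite_set A -> \forall n \near \oo, ~ A n.
Proof.
by move=> /finite_set_near_sub; apply: filterS => n An /An; rewrite /= ltnn.
Qed.

Lemma cvgny_finiteP (b : nat -> nat) :
  b @ \oo --> \oo <-> forall n, finite_set (b @^-1` `I_n).
Proof.
rewrite cvgnyPge; split=> bP n.
  have [N _ bN] := bP n; apply: sub_finite_set (finite_II N) => x /= bx.
  by rewrite ltnNge; apply/negP => /bN /=; rewrite leqNgt bx.
by apply: filterS (finite_set_near_notin (bP n)) => x /negP; rewrite -leqNgt.
Qed.

Lemma injective_cvgny (s : nat -> nat) : injective s -> s @ \oo --> \oo.
Proof.
move=> sinj; apply/cvgny_finiteP => n; apply: finite_preimage (finite_II n).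
by move=> x y _ _; exact: sinj.
Qed.

Lemma cvg_even_odd (T : Type) (F : set_system T) (u : nat -> T) : Filter F ->
  u n.*2 @[n --> \oo] --> F -> u n.*2.+1 @[n --> \oo] --> F ->
  u n @[n --> \oo] --> F.
Proof.
move=> FF ue uo A FA; have [N _ evenA] := ue A FA; have [M _ oddA] := uo A FA.
exists (maxn N M).*2 => // n /=; rewrite -(odd_double_half n).
case: (odd n) => /= large.
  by apply: oddA => /=; lia.
by apply: evenA => /=; lia.
Qed.

Lemma ge0_cvgr0P (R : realFieldType) (T : Type) (F : set_system T)
    {FF : Filter F} (u : T -> R) : (forall t, 0 <= u t) ->
  u t @[t --> F] --> 0 <-> forall e, 0 < e -> \forall t \near F, u t <= e.
Proof.
move=> u0; rewrite cvgr0Pnorm_le.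
by split=> u_le e /u_le; apply: filterS => t; rewrite ger0_norm.
Qed.

Section block_ideals.
Context (R : realType) (w : nat -> R) (b : nat -> nat).
Implicit Types (A B : set nat) (n : nat).

Definition block_mass n A : R := \sum_(x \in A `&` b @^-1` [set n]) w x.

Definition block_ideal : set (set nat) :=
  [set A | block_mass n A @[n --> \oo] --> 0].

Hypotheses (w_ge0 : forall x, 0 <= w x) (b_cvgny : b @ \oo --> \oo).

Lemma finite_block n : finite_set (b @^-1` [set n]).
Proof.
by apply: sub_finite_set ((cvgny_finiteP b).1 b_cvgny n.+1) => x /= ->.
Qed.

Lemma block_mass_ge0 n A : 0 <= block_mass n A.
Proof. by apply: fsumr_ge0 => x _. Qed.

Lemma block_massU n A B : A `&` B = set0 ->
  block_mass n (A `|` B) = block_mass n A + block_mass n B.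
Proof.
move=> AB; have finI C : finite_set (C `&` b @^-1` [set n]).
  exact/finite_setIr/finite_block.
by rewrite /block_mass setIUl fsbigU0// => x [[Ax _] [Bx _]]; rewrite -AB.
Qed.

Lemma le_block_mass n A B : A `<=` B -> block_mass n A <= block_mass n B.
Proof.
move=> AB; rewrite -(setDUK AB) block_massU ?setDIK//.
by rewrite lerDl block_mass_ge0.
Qed.

Lemma block_mass_eq0 n A : ~ (b @` A) n -> block_mass n A = 0.
Proof.
move=> An; rewrite /block_mass (_ : _ `&` _ = set0) ?fsbig_set0//.
by apply/seteqP; split=> // x [Ax bx]; apply: An; exists x.
Qed.

Lemma block_mass_set1 x : block_mass (b x) [set x] = w x.
Proof. by rewrite /block_mass setIidl ?fsbig_set1// => _ ->. Qed.

Lemma block_idealP A : block_ideal A <->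
  forall e, 0 < e -> \forall n \near \oo, block_mass n A <= e.
Proof. by apply: ge0_cvgr0P => n; exact: block_mass_ge0. Qed.

Lemma block_idealS A B : A `<=` B -> block_ideal B -> block_ideal A.
Proof.
move=> AB /block_idealP IB; apply/block_idealP => e /IB.
by apply: filterS => n; apply: le_trans; exact: le_block_mass.
Qed.

Lemma block_idealU A B :
  block_ideal A -> block_ideal B -> block_ideal (A `|` B).
Proof.
move=> IA IB; have -> : A `|` B = A `|` (B `\` A).
  by rewrite setDE setUIr setUv setIT.
rewrite /block_ideal /=; under eq_fun do rewrite block_massU ?setDIK//.
rewrite -[0]addr0; apply: cvgD => //.
by apply: block_idealS IB => x [].
Qed.

Lemma block_ideal_finite A : finite_set A -> block_ideal A.
Proof.
move=> /(finite_image b)/finite_set_near_notin bA; apply/block_idealP => e e0.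
by apply: filterS bA => n /block_mass_eq0 ->; exact: ltW.
Qed.

End block_ideals.

(** * Consequences of the Nikodym property *)

Definition proper_ideal (T : Type) (I : set (set T)) : Prop :=
  [/\ forall A B, A `<=` B -> I B -> I A,
      forall A B, I A -> I B -> I (A `|` B) & ~ I setT].

Section dual_correction.
Context (R : realType) (I : set (set nat)).
Hypothesis properI : proper_ideal I.
Implicit Types (W : set nat -> R) (X Y : set nat).

Definition dual_correction W X : R :=
  W X - if `[< I X >] then 0 else W setT.

Lemma proper_idealC X : I X -> ~ I (~` X).
Proof.
by case: properI => _ IU IT IX ICX; apply: IT; rewrite -(setUv X); exact: IU.
Qed.

Lemma dual_correction_ideal W X : I X -> dual_correction W X = W X.
Proof. by move=> IX; rewrite /dual_correction asboolT// subr0. Qed.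

Lemma dual_correctionC W X : finitely_additive setT W -> I X ->
  dual_correction W (~` X) = - W X.
Proof.
move=> addW IX; rewrite /dual_correction asboolF; last exact: proper_idealC.
by rewrite -(setUv X) addW ?setICr//; lra.
Qed.

Lemma dual_correction_additive W : finitely_additive setT W ->
  finitely_additive (I `|` dual_filter I) (dual_correction W).
Proof.
move=> addW; have [IS IU _] := properI.
have mixed X Y : I X -> I Y -> X `&` ~` Y = set0 ->
    dual_correction W (X `|` ~` Y) =
    dual_correction W X + dual_correction W (~` Y).
  move=> IX IY /disjoints_subset; rewrite setCK => XY.
  have -> : X `|` ~` Y = ~` (Y `\` X) by rewrite setCD setUC.
  rewrite !dual_correctionC//; last by apply: IS IY => x [].
  by rewrite dual_correction_ideal// -[in RHS](setDUK XY) addW ?setDIK//; lra.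
move=> A B [IA|[X IX <-]] [IB|[Y IY <-]] AB.
- by rewrite !dual_correction_ideal ?addW//; exact: IU.
- exact: mixed.
- by rewrite setUC addrC mixed// setIC.
- exfalso; apply: proper_idealC IX _; apply: IS IY.
  by rewrite -[X in _ `<=` X]setCK; apply/disjoints_subset.
Qed.

Lemma nikodym_ideal_bounded (W : nat -> set nat -> R) :
  nikodym R (I `|` dual_filter I) ->
  (forall n, finitely_additive setT (W n)) -> (forall n X, 0 <= W n X) ->
  (forall X, I X -> W n X @[n --> \oo] --> 0) ->
  exists M, forall n X, I X -> W n X <= M.
Proof.
move=> nik addW W0 cW; have [IS _ _] := properI.
have [n|n|X [IX|[Y IY <-]]|M WM] := nik (fun n => dual_correction (W n)).
- exact: dual_correction_additive.
- have WT X : W n X <= W n setT by rewrite -(setUv X) addW ?setICr// lerDl.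
  exists (W n setT) => X [IX|[Y IY <-]].
    by rewrite dual_correction_ideal// ger0_norm.
  by rewrite dual_correctionC// normrN ger0_norm.
- by under eq_fun do rewrite dual_correction_ideal//; exact: cW.
- under eq_fun do rewrite dual_correctionC//.
  by rewrite -oppr0; apply: cvgN; exact: cW.
exists M => n X IX; rewrite -lee_fin; apply: le_trans (WM n).
apply: le_ereal_sup_tmp.
exists (`|dual_correction (W n) X| + `|dual_correction (W n) set0|)%:E.
  exists X, set0; split=> //; [by left|left|by rewrite setI0].
  exact: IS IX.
by rewrite lee_fin dual_correction_ideal// ger0_norm// lerDl.
Qed.

End dual_correction.

Section nikodym_block_ideals.
Context (R : realType) (w : nat -> R) (b : nat -> nat).
Hypotheses (w_ge0 : forall x, 0 <= w x) (b_cvgny : b @ \oo --> \oo).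
Let I := block_ideal w b.
Hypotheses (IT : ~ I setT) (nikI : nikodym R (I `|` dual_filter I)).

Let proper_block_ideal : proper_ideal I.
Proof. by split=> // [A B|A B]; [exact: block_idealS|exact: block_idealU]. Qed.

Lemma nikodym_block_mass_bounded :
  exists M, forall n, block_mass w b n setT <= M.
Proof.
have [n X Y _ _|n X|X //|M WM] :=
    nikodym_ideal_bounded (W := block_mass w b) proper_block_ideal nikI.
- exact: block_massU.
- exact: block_mass_ge0.
exists M => n.
have := WM n _ (block_ideal_finite b w_ge0 (finite_block b_cvgny n)).
by rewrite /block_mass setIid setTI.
Qed.

(* Were the weights not tending to [0], the measures [n] times the unit mass  *)
(* at [n], for the [n] of weight above some [e], would tend to [0] on [I].    *)
Lemma nikodym_weight_cvg0 : w x @[x --> \oo] --> 0.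
Proof.
apply/ge0_cvgr0P => // e e0.
pose W n (X : set nat) : R := if (e < w n) && (n \in X) then n%:R else 0.
have [n X Y _ _ XY|n X|X IX|M WM] :=
    nikodym_ideal_bounded (W := W) proper_block_ideal nikI.
- rewrite /W in_setU; case: (e < w n) => /=; last by rewrite addr0.
  have [nX|nX] := boolP (n \in X); have [nY|nY] := boolP (n \in Y);
    rewrite ?addr0 ?add0r//.
  by exfalso; rewrite -[False]/(set0 n) -XY; split; exact/set_mem.
- by rewrite /W; case: ifP.
- have small : \forall n \near \oo, block_mass w b (b n) X <= e.
    exact: b_cvgny ((block_idealP b w_ge0 X).1 IX e e0).
  apply: cvg_near_cst; apply: filterS small => n small; rewrite /W ifF//.
  apply/negP => /andP[]; rewrite ltNge => /negP wn /set_mem Xn; apply: wn.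
  apply: le_trans small; rewrite -(block_mass_set1 w b n).
  by apply: le_block_mass => // _ ->.
near=> x; rewrite leNgt; apply/negP => ewx.
have := WM x _ (block_ideal_finite b w_ge0 (finite_set1 x)).
rewrite /W ewx mem_set//=.
apply/negP; rewrite -ltNge; near: x; exact: nbhs_infty_gtr.
Unshelve. all: by end_near. Qed.

End nikodym_block_ideals.

(** * Density ideals are block ideals *)

Lemma ge0_cvge0P (R : realFieldType) (T : Type) (F : set_system T)
    {FF : Filter F} (u : T -> \bar R) : (forall t, 0 <= u t)%E ->
  u t @[t --> F] --> 0%E <->
  forall e : R, 0 < e -> \forall t \near F, (u t <= e%:E)%E.
Proof.
move=> u0; split=> [cu e e0|u_le].
  have : \forall t \near F, (u t < e%:E)%E.
    exact: cu (nbhs_open_ereal_lt (f := fun=> e) e0).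
  by apply: filterS => t; exact: ltW.
have u_fin : \forall t \near F, u t \is a fin_num.
  apply: filterS (u_le 1 ltr01) => t u_le1.
  by rewrite ge0_fin_numE// (le_lt_trans u_le1) ?ltry.
apply/fine_cvgP; split=> //.
apply/ge0_cvgr0P => [t|e e0]; first exact: fine_ge0.
by apply: filterS2 u_fin (u_le e e0) => t fin; rewrite -lee_fin fineK.
Qed.

Section msupport.
Context (R : realType) (mu : {finite_measure set nat -> \bar R}).
Implicit Types A : set nat.

Lemma measure_msupportC : mu (~` msupport mu) = 0%E.
Proof.
rewrite -[~` _]image_id -bigcup_imset1 measure_bigcup//=; last first.
  by move=> i j _ _ [x [/= -> ->]].
apply: eseries0 => i _ /=; rewrite in_setE /msupport /= => /negP.
by rewrite negbK => /eqP.
Qed.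

Lemma measure_msupportI A : mu (A `&` msupport mu) = mu A.
Proof.
rewrite -[in RHS](setUIDK A (msupport mu)) measureU//=; last first.
  by apply/seteqP; split=> // x [[_ ?] [_]].
rewrite [X in (_ + X)%E](_ : _ = 0%E) ?adde0//.
apply/eqP; rewrite eq_le measure_ge0 andbT -measure_msupportC.
by apply: le_measure; rewrite ?inE// => x [].
Qed.

Lemma measure_finite_msupport A : finite_set (msupport mu) ->
  fine (mu A) = \sum_(x \in A `&` msupport mu) fine (mu [set x]).
Proof.
move=> finS; have finA := finite_setIr A finS.
rewrite -measure_msupportI -[X in mu X]image_id -bigcup_imset1.
rewrite measure_fin_bigcup//=; last by move=> i j _ _ [x [/= -> ->]].
have -> : (\sum_(x \in A `&` msupport mu) mu [set x] =
    \sum_(x \in A `&` msupport mu) (fine (mu [set x]))%:E)%E.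
  by apply: eq_fsbigr => x _; rewrite fineK// fin_num_measure.
by rewrite fsumEFin.
Qed.

Lemma measure_eq0_disjoint A : A `&` msupport mu = set0 -> mu A = 0%E.
Proof. by rewrite -measure_msupportI => ->; rewrite measure0. Qed.

End msupport.

Section density_ideals.
Context (R : realType) (mu : nat -> {finite_measure set nat -> \bar R}).
Hypothesis finite_msupport : forall n, finite_set (msupport (mu n)).
Hypothesis trivIset_msupport : trivIset setT (fun n => msupport (mu n)).
Implicit Types A : set nat.

Let phi A : \bar R := ereal_sup (range (fun n => mu n A)).

Lemma near_msupport_disjoint (F : set nat) : finite_set F ->
  \forall n \near \oo, F `&` msupport (mu n) = set0.
Proof.
move=> finF; pose index x := xget 0%N [set n | msupport (mu n) x].
apply: filterS (finite_set_near_notin (finite_image index finF)) => n Fn.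
apply/seteqP; split=> // x [Fx nx]; apply: Fn; exists x => //.
apply: xget_subset1 => // i j ix jx.
by apply: trivIset_msupport => //; exists x.
Qed.

Lemma near_msupport_sub m :
  \forall n \near \oo, forall k, (k < m)%N -> msupport (mu k) `<=` `I_n.
Proof.
have : finite_set (\bigcup_(k < m) msupport (mu k)) by exact: bigcup_finite.
move=> /finite_set_near_sub; apply: filterS => n sub k km x kx.
by apply: sub; exists k.
Qed.

Lemma exh_ereal_sup : exh phi = [set A | fine (mu n A) @[n --> \oo] --> 0].
Proof.
have phi_ge0 A : (0 <= phi A)%E.
  by apply: le_ereal_sup_tmp; exists (mu 0%N A) => //; exists 0%N.
have mu_fin n A : mu n A \is a fin_num by exact: fin_num_measure.
have fine_mu_ge0 n A : 0 <= fine (mu n A) by exact: fine_ge0.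
apply/seteqP; split=> A; rewrite /exh /= ge0_cvge0P// ge0_cvgr0P//.
- move=> small e /small[N _ /(_ N (leqnn _)) /= phi_le].
  apply: filterS (near_msupport_disjoint (finite_II N.+1)) => n disj.
  rewrite -lee_fin fineK//; apply: le_trans phi_le.
  apply: (@le_trans _ _ (mu n (A `\` `I_N.+1))).
    rewrite -measure_msupportI -[leRHS]measure_msupportI.
    apply: le_measure; rewrite ?inE// => x [Ax nx]; split=> //; split=> // xN.
    by rewrite -[False]/(set0 x) -disj.
  by apply: ereal_sup_ubound; exists n.
move=> small e e0; have [m _ mu_le] := small e e0.
apply: filterS (near_msupport_sub m) => n sub.
apply: ge_ereal_sup => _ [k _ <-]; have [mk|km] := leqP m k.
  apply: (@le_trans _ _ (mu k A)).
    by apply: le_measure; rewrite ?inE// => x [].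
  by rewrite -(fineK (mu_fin k A)) lee_fin; exact: mu_le.
rewrite measure_eq0_disjoint ?lee_fin ?ltW//.
apply/seteqP; split=> // x [[_ nx] /(sub k km) xn]; apply: nx => /=.
exact: ltnW.
Qed.

(* The support of [mu n] becomes block [2 n], and a point [x] outside all     *)
(* supports becomes block [2 x + 1] on its own, with a weight tending to [0]. *)
Definition support_block (x : nat) : nat :=
  xget x.*2.+1 [set j | exists2 n, msupport (mu n) x & n.*2 = j].

Definition support_weight (x : nat) : R :=
  if odd (support_block x) then x.+1%:R^-1
  else fine (mu (support_block x)./2 [set x]).

Lemma support_block_in n x : msupport (mu n) x -> support_block x = n.*2.
Proof.
move=> nx; apply: xget_subset1; first by exists n.
move=> p q [i ix <-] [j jx <-]; congr _.*2.
by apply: trivIset_msupport => //; exists x.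
Qed.

Lemma support_block_out x :
  (forall n, ~ msupport (mu n) x) -> support_block x = x.*2.+1.
Proof. by move=> xout; apply: xgetPN => j [n /xout]. Qed.

Lemma support_blockP x :
  (exists2 n, msupport (mu n) x & support_block x = n.*2) \/
  support_block x = x.*2.+1.
Proof.
have [[n nx]|/forallNP xout] := pselect (exists n, msupport (mu n) x).
  by left; exists n => //; exact: support_block_in.
by right; exact: support_block_out.
Qed.

Lemma support_block_even n :
  support_block @^-1` [set n.*2] = msupport (mu n).
Proof.
apply/seteqP; split=> [x /= bx|x]; last exact: support_block_in.
case: (support_blockP x) => [[m mx]|]; rewrite bx.
  by move=> /double_inj ->.
by move/(congr1 odd); rewrite /= !odd_double.
Qed.

Lemma support_block_odd n : support_block @^-1` [set n.*2.+1] `<=` [set n].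
Proof.
move=> x /= bx; case: (support_blockP x) => [[m mx]|]; rewrite bx.
  by move/(congr1 odd); rewrite /= !odd_double.
by move=> [/double_inj].
Qed.

Lemma support_block_cvgny : support_block @ \oo --> \oo.
Proof.
apply/cvgny_finiteP => n.
apply: (@sub_finite_set _ _ (\bigcup_(k < n) msupport (mu k) `|` `I_n)).
  move=> x /= bn.
  case: (support_blockP x) => [[m mx bx]|bx]; [left|right] => /=.
    by exists m => //=; rewrite bx in bn; lia.
  by rewrite bx in bn; lia.
by rewrite finite_setU; split; [exact: bigcup_finite|exact: finite_II].
Qed.

Lemma support_weight_gt0 x : 0 < support_weight x.
Proof.
rewrite /support_weight; case: (support_blockP x) => [[n nx ->]|->].
  rewrite odd_double doubleK fine_gt0// lt0e measure_ge0 ltey_eq.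
  by rewrite fin_num_measure// !andbT.
by rewrite /= odd_double invr_gt0.
Qed.

Lemma block_mass_support_even n A :
  block_mass support_weight support_block n.*2 A = fine (mu n A).
Proof.
rewrite measure_finite_msupport// /block_mass support_block_even.
apply: eq_fsbigr => x; rewrite in_setI => /andP[_ /set_mem nx].
by rewrite /support_weight (support_block_in nx) odd_double doubleK.
Qed.

Lemma block_mass_support_odd n A :
  block_mass support_weight support_block n.*2.+1 A <= n.+1%:R^-1.
Proof.
have An : A `&` support_block @^-1` [set n.*2.+1] `<=` [set n].
  by move=> x [_ /support_block_odd].
rewrite /block_mass; case: (subset_set1 An) => [->|AE].
  by rewrite fsbig_set0 invr_ge0.
have [_ bn] : (A `&` support_block @^-1` [set n.*2.+1]) n by rewrite AE.
by rewrite AE fsbig_set1 /support_weight bn /= odd_double.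
Qed.

Lemma exh_block_ideal : exh phi = block_ideal support_weight support_block.
Proof.
rewrite exh_ereal_sup; apply/seteqP; split=> A /=; last first.
  move=> /(cvg_comp _ _ (injective_cvgny double_inj)).
  by under eq_cvg do rewrite /= block_mass_support_even.
move=> mu0; apply: cvg_even_odd.
  by under eq_cvg do rewrite block_mass_support_even.
apply: (squeeze_cvg0 (v := harmonic)) cvg_harmonic; apply: nearW => n.
rewrite block_mass_support_odd andbT.
by apply: block_mass_ge0 => x; apply/ltW/support_weight_gt0.
Qed.

End density_ideals.

Lemma density_ideal_block_ideal (R : realType) (I : set (set nat)) :
  density_ideal R I -> exists (w : nat -> R) (b : nat -> nat),
    [/\ forall x, 0 < w x, b @ \oo --> \oo & I = block_ideal w b].
Proof.
move=> [_ [[mu [finS trivS ->]] -> _]].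
exists (support_weight mu), (support_block mu); split.
- exact: support_weight_gt0.
- exact: support_block_cvgny.
- exact: exh_block_ideal.
Qed.

(** * From blocks to an Erdos-Ulam function *)

Section reindexing.
Context (R : realType) (w : nat -> R) (b s : nat -> nat).
Hypotheses (w_ge0 : forall x, 0 <= w x) (s_inj : injective s).

Lemma block_mass_reindex n A :
  block_mass w (s \o b) (s n) A = block_mass w b n A.
Proof.
by rewrite /block_mass; congr (\sum_(x \in _) _); apply/seteqP;
  split=> x [Ax] => [/s_inj|/= ->].
Qed.

Lemma block_mass_reindexP j A : (exists2 n, j = s n &
  block_mass w (s \o b) j A = block_mass w b n A) \/
  block_mass w (s \o b) j A = 0.
Proof.
have [[n _ <-]|sNj] := pselect (range s j).
  by left; exists n; rewrite // block_mass_reindex.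
by right; apply: block_mass_eq0 => -[x _ sx]; apply: sNj; exists (b x).
Qed.

Lemma block_ideal_reindex : block_ideal w (s \o b) = block_ideal w b.
Proof.
apply/seteqP; split=> A.
  move=> /(cvg_comp _ _ (injective_cvgny s_inj)).
  by under eq_cvg do rewrite /= block_mass_reindex.
move=> /block_idealP-/(_ w_ge0) IA; apply/block_idealP => // e e0.
have [N _ small] := IA e e0.
apply: filterS (finite_set_near_notin (finite_image s (finite_II N))) => j sNj.
case: (block_mass_reindexP j A) => [[n jn ->]|->]; last exact: ltW.
by apply: small; rewrite /= leqNgt; apply/negP => nN; apply: sNj; exists n.
Qed.

End reindexing.

Lemma infinite_set_to_even (B : set nat) : infinite_set B ->
  exists2 s : nat -> nat, injective s & forall k, exists2 n, B n & s n = k.*2.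
Proof.
move=> infB.
have /card_set_bijP[g [_ g_inj g_surj]] := eq_card_nat (countableP B) infB.
exists (fun n => if n \in B then (g n).*2 else n.*2.+1); last first.
  by move=> k; have [n Bn <-] := g_surj k I; exists n => //; rewrite mem_set.
move=> m n; case: ifPn => mB; case: ifPn => nB.
- by move/double_inj/g_inj; apply.
- by move/(congr1 odd); rewrite /= !odd_double.
- by move/(congr1 odd); rewrite /= !odd_double.
- by move=> [/double_inj].
Qed.

Lemma proper_block_ideal_infinite (R : realType) (w : nat -> R)
    (b : nat -> nat) :
  (forall x, 0 <= w x) -> ~ block_ideal w b setT ->
  exists2 c, 0 < c & infinite_set [set n | c < block_mass w b n setT].
Proof.
move=> w_ge0 IT; apply: contrapT => finI; apply: IT.
apply/block_idealP => // c c0.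
have /finite_set_near_notin : finite_set [set n | c < block_mass w b n setT].
  by apply: contrapT => infc; apply: finI; exists c.
by apply: filterS => n /negP; rewrite -leNgt.
Qed.

Section dyadic_means.
Context (R : realType).
Implicit Type a : nat -> R.

Definition dyadic_sum a n : R := \sum_(i < n) 2 ^+ i * a i.

Lemma dyadic_sumS a n : dyadic_sum a n.+1 = dyadic_sum a n + 2 ^+ n * a n.
Proof. by rewrite /dyadic_sum big_ord_recr. Qed.

Lemma dyadic_sum_ge0 a n : (forall i, 0 <= a i) -> 0 <= dyadic_sum a n.
Proof. by move=> a0; apply: sumr_ge0 => i _; rewrite mulr_ge0// exprn_ge0. Qed.

Lemma dyadic_sum_le a M n :
  0 <= M -> (forall i, a i <= M) -> dyadic_sum a n <= M * 2 ^+ n.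
Proof.
move=> M0 aM; elim: n => [|n IH]; first by rewrite /dyadic_sum big_ord0 mulr1.
have : 2 ^+ n * a n <= 2 ^+ n * M by rewrite ler_pM2l// exprn_gt0.
by rewrite dyadic_sumS exprS; lra.
Qed.

Lemma dyadic_sum_ge a c n : (forall i, 0 <= a i) -> (forall k, c <= a k.*2) ->
  c / 4 * 2 ^+ n.+1 <= dyadic_sum a n.+1.
Proof.
move=> a0 ac; pose m := n./2; have := dyadic_sum_ge0 m.*2 a0.
have p0 : 0 < 2 ^+ m.*2 :> R by rewrite exprn_gt0.
have := mulr_ge0 (ltW p0) (a0 m.*2).
have : 2 ^+ m.*2 * c <= 2 ^+ m.*2 * a m.*2 by rewrite ler_pM2l.
rewrite -[n]odd_double_half -/m; case: (odd n); rewrite ?add1n ?add0n.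
  rewrite !dyadic_sumS !exprS; have : 0 <= 2 * 2 ^+ m.*2 * a m.*2.+1.
    by rewrite !mulr_ge0// ltW.
  lra.
by rewrite dyadic_sumS exprS; lra.
Qed.

Lemma dyadic_mean_cvg0 a : (forall i, 0 <= a i) ->
  dyadic_sum a n / 2 ^+ n @[n --> \oo] --> 0 <-> a n @[n --> \oo] --> 0.
Proof.
move=> a0; have p0 n : 0 < 2 ^+ n :> R by rewrite exprn_gt0.
have mean_ge0 n : 0 <= dyadic_sum a n / 2 ^+ n.
  by rewrite divr_ge0 ?dyadic_sum_ge0// ltW.
split=> [mean0|/ge0_cvgr0P-/(_ a0) a_le].
  apply: (squeeze_cvg0 (v := fun n => 2 * (dyadic_sum a n.+1 / 2 ^+ n.+1))).
    apply: nearW => n; rewrite a0 mulrA ler_pdivlMr//= dyadic_sumS exprS.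
    by have := dyadic_sum_ge0 n a0; lra.
  rewrite -[0](mulr0 2); apply: cvgMr.
  by rewrite (cvg_shiftS (fun n => dyadic_sum a n / 2 ^+ n)).
apply/ge0_cvgr0P => // e e0; have [N _ aN] := a_le _ (divr_gt0 e0 (ltr0Sn R 1)).
have tail n : (N <= n)%N -> dyadic_sum a n <= dyadic_sum a N + e / 2 * 2 ^+ n.
  have e2 k : 0 <= e / 2 * 2 ^+ k by rewrite mulr_ge0 ?(ltW (p0 k))//; lra.
  elim: n => [|n IH]; first by rewrite leqn0 => /eqP ->; rewrite lerDl.
  rewrite leq_eqVlt ltnS => /predU1P[<-|Nn]; first by rewrite lerDl.
  have : 2 ^+ n * a n <= 2 ^+ n * (e / 2) by rewrite ler_pM2l ?aN.
  by have := IH Nn; rewrite dyadic_sumS exprS; lra.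
have half_lt1 : `|2^-1 : R| < 1 by rewrite ger0_norm; lra.
have := cvg_geometric (dyadic_sum a N) half_lt1.
move=> /cvgr0Pnorm_le/(_ _ (divr_gt0 e0 (ltr0Sn R 1))) head_le.
near=> n; rewrite ler_pdivrMr//.
apply: le_trans (tail n _) _; first by near: n; exact: nbhs_infty_ge.
rewrite [e in leRHS]splitr mulrDl lerD2r -ler_pdivrMr// -exprVn.
by apply: le_trans (ler_norm _) _; near: n.
Unshelve. all: by end_near. Qed.

End dyadic_means.

Lemma exists_minimizer (T : Type) (b : T -> nat) (U : set T) : U !=set0 ->
  exists x, U x /\ forall y, U y -> (b x <= b y)%N.
Proof.
move=> [x0 Ux0]; have exb : exists n, `[< exists2 x, U x & b x = n >].
  by exists (b x0); apply/asboolP; exists x0.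
case: (ex_minnP exb) => _ /asboolP[x Ux <-] minb.
by exists x; split=> // y Uy; apply: minb; apply/asboolP; exists y.
Qed.

(* Repeatedly list a remaining point of least [b]. A point never listed would *)
(* bound [b] on the infinitely many listed ones.                              *)
Lemma nondecreasing_rearrangement (b : nat -> nat) : b @ \oo --> \oo ->
  exists2 e : nat -> nat, bijective e & {homo b \o e : m n / (m <= n)%N}.
Proof.
move=> b_cvgny.
pose pick U := xget 0%N [set x | U x /\ forall y, U y -> (b x <= b y)%N].
have pickP U : U !=set0 -> U (pick U) /\ forall y, U y -> (b (pick U) <= b y)%N.
  by move=> U0; exact: xgetPex (exists_minimizer b U0).
pose U n := iter n (fun U => U `\ pick U) setT; pose e n := pick (U n).
have infU n : infinite_set (U n).
  elim: n => [|n IH]; first exact: infinite_nat.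
  exact: infinite_setD IH (finite_set1 _).
have Ue n := pickP (U n) (infinite_setN0 (infU n)).
have Usub : {homo U : m n / (m <= n)%N >-> n `<=` m}.
  apply: homo_leq => [V x //|V V1 V2 VV1 VV2|n x []//].
  exact: subset_trans VV1.
have e_inj : injective e.
  move=> m n; case: (ltngtP m n) => // lt emn.
    by have [_ []] := Usub _ _ lt _ (Ue n).1; rewrite -/(e n) -emn.
  by have [_ []] := Usub _ _ lt _ (Ue m).1; rewrite -/(e m) emn.
have e_surj x : exists n, e n = x.
  apply: contrapT => /forallNP xNe.
  have Ux n : U n x by elim: n => [//|n IH]; split=> // /esym/xNe.
  have : infinite_set (range e) := infinite_range e_inj.
  apply; apply: sub_finite_set ((cvgny_finiteP b).1 b_cvgny (b x).+1).
  by move=> _ [n _ <-]; exact: (Ue n).2.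
exists e; last by move=> m n mn; apply: (Ue m).2; exact: Usub mn _ (Ue n).1.
have /choice[h hK] := e_surj.
by exists h => // n; apply: e_inj; rewrite hK.
Qed.

Lemma nondecreasing_adjoint (u : nat -> nat) :
  {homo u : m n / (m <= n)%N} -> u @ \oo --> \oo ->
  exists2 L : nat -> nat, L @ \oo --> \oo &
    forall n j, (u n < j)%N = (n < L j)%N.
Proof.
move=> u_homo u_cvgny.
have /choice[L uL] j : exists l, forall n, (u n < j)%N = (n < l)%N.
  have exj : exists n, (j <= u n)%N.
    have [N _ uN] := (cvgnyPge _).1 u_cvgny j.
    by exists N; exact: uN N (leqnn N).
  case: (ex_minnP exj) => l jl minl; exists l => n.
  rewrite !ltnNge; congr negb; apply/idP/idP => [/minl //|ln].
  exact: leq_trans jl (u_homo _ _ ln).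
exists L; last by move=> n j; exact: uL.
apply/cvgnyPge => n; exists (u n).+1 => // j /=.
by rewrite uL => /ltnW.
Qed.

Section block_permutation.
Context (R : realType) (w : nat -> R) (b e : nat -> nat).
Hypothesis e_bij : bijective e.

Lemma block_mass_permute n A :
  block_mass (w \o e) (b \o e) n A = block_mass w b n (e @` A).
Proof.
have -> : block_mass w b n (e @` A) =
    \sum_(x \in e @` (A `&` (b \o e) @^-1` [set n])) w x.
  congr (\sum_(x \in _) _); apply/seteqP.
  split=> [_ [[x Ax <-] bx]|_ [x [Ax bx] <-]]; first by exists x.
  by split=> //; exists x.
by rewrite fsbig_image// => x y _ _ /(bij_inj e_bij).
Qed.

Lemma block_ideal_permute :
  ideal_isomorphic (block_ideal w b) (block_ideal (w \o e) (b \o e)).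
Proof.
case: (e_bij) => h eK hK; exists h => [|A]; first by exists e.
have ehA : e @` (h @` A) = A.
  by rewrite image_comp eq_image_id// => x _ /=; rewrite hK.
rewrite /block_ideal /=.
by under [X in _ <-> X]eq_cvg do rewrite block_mass_permute ehA.
Qed.

End block_permutation.

Definition dyadic_mass (R : realType) (w : nat -> R) (b : nat -> nat)
    (A : set nat) (j : nat) : R :=
  dyadic_sum (fun i => block_mass w b i A) j.

Section erdos_ulam_blocks.
Context (R : realType) (w : nat -> R) (b : nat -> nat) (c M : R).
Hypotheses (w_gt0 : forall x, 0 < w x) (w_cvg0 : w x @[x --> \oo] --> 0).
Hypotheses (b_homo : {homo b : m n / (m <= n)%N}) (b_cvgny : b @ \oo --> \oo).
Hypothesis c_gt0 : 0 < c.
Hypothesis mass_ge :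
  forall j, c * 2 ^+ j.+1 <= dyadic_mass w b setT j.+1.
Hypothesis mass_le : forall j, dyadic_mass w b setT j <= M * 2 ^+ j.

Definition dyadic_weight (x : nat) : R := 2 ^+ b x * w x.

Let f := dyadic_weight.

Let pow2_gt0 j : 0 < 2 ^+ j :> R. Proof. by rewrite exprn_gt0. Qed.

Lemma dyadic_weight_gt0 x : 0 < f x.
Proof. by rewrite mulr_gt0. Qed.

Let f_gt0 := dyadic_weight_gt0.

Let mass_ge0 A i : 0 <= block_mass w b i A.
Proof. by apply: block_mass_ge0 => x; exact: ltW. Qed.

Lemma partial_sum_dyadic_weight A n j : `I_n = b @^-1` `I_j ->
  partial_sum f A n = dyadic_mass w b A j.
Proof.
have finI k : finite_set (A `&` b @^-1` `I_k).
  by apply: finite_setIr; exact: ((cvgny_finiteP b).1 b_cvgny).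
rewrite partial_sum_fsbig => ->; elim: j => [|j IH].
  rewrite /dyadic_mass /dyadic_sum big_ord0 (_ : _ `&` _ = set0) ?fsbig_set0//.
  by apply/seteqP; split=> // x [].
rewrite /dyadic_mass dyadic_sumS -/(dyadic_mass w b A j) -IH.
have -> : A `&` b @^-1` `I_j.+1 =
    (A `&` b @^-1` `I_j) `|` (A `&` b @^-1` [set j]).
  rewrite -setIUr -preimage_setU; congr (_ `&` _ @^-1` _).
  apply/seteqP; split=> i /=; last by case=> [/ltnW|->].
  by rewrite ltnS leq_eqVlt => /predU1P[->|]; [right|left].
rewrite fsbigU0//; last 2 first.
- by apply: finite_setIr; exact: finite_block.
- by move=> x [[_ /= +] [_ /= bx]]; rewrite bx ltnn.
congr (_ + _); rewrite /block_mass mulr_fsumr; apply: eq_fsbigr => x.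
by rewrite in_setI => /andP[_ /set_mem /= <-].
Qed.

Lemma partial_sum_dyadic_weight_le A n :
  partial_sum f A n <= dyadic_mass w b A (b n).+1.
Proof.
have [L _ bL] := nondecreasing_adjoint b_homo b_cvgny.
rewrite -(@partial_sum_dyadic_weight A (L (b n).+1)); last first.
  by apply/seteqP; split=> x /=; rewrite bL.
by apply: le_partial_sum => //; apply: ltnW; rewrite -bL.
Qed.

Lemma total_sum_dyadic_weight_ge n : (0 < b n)%N ->
  c * 2 ^+ b n <= total_sum f n.
Proof.
have [L _ bL] := nondecreasing_adjoint b_homo b_cvgny.
case bn: (b n) => [//|j] _; apply: le_trans (mass_ge j) _.
rewrite -(@partial_sum_dyadic_weight setT (L j.+1)); last first.
  by apply/seteqP; split=> x /=; rewrite bL.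
by rewrite partial_sumT le_total_sum// leqNgt -bL bn ltnn.
Qed.

Lemma near_block_gt0 : \forall n \near \oo, (0 < b n)%N.
Proof. exact: (cvgnyPgt _).1 b_cvgny 0%N. Qed.

Lemma erdos_ulam_dyadic_weight : erdos_ulam_fun f.
Proof.
split=> //.
  apply/cvgryPge => C.
  have /cvgryPge/(_ (C / c)) : ((b n)%:R : R) @[n --> \oo] --> +oo.
    exact/cvgrnyP.
  apply: filterS2 near_block_gt0 => n b0; rewrite ler_pdivrMr// mulrC => Cb.
  apply: le_trans Cb (le_trans _ (total_sum_dyadic_weight_ge b0)).
  by rewrite ler_pM2l// -natrX ler_nat ltnW// ltn_expl.
apply: (squeeze_cvg0 (v := fun n => c^-1 * w n)); last first.
  by rewrite -[0](mulr0 c^-1); apply: cvgMr.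
apply: filterS near_block_gt0 => n b0.
have total_gt0 := total_sumS_gt0 f_gt0 n.
rewrite divr_ge0 ?(ltW (f_gt0 n)) ?(ltW total_gt0)//= ler_pdivrMr//.
have := total_sum_dyadic_weight_ge b0.
move=> /le_trans/(_ (le_total_sum f_gt0 (leqnSn n))) total_ge.
by rewrite -mulrA ler_pdivlMl// /f /dyadic_weight mulrA mulrC ler_pM2l.
Qed.

Let massP A : dyadic_mass w b A j / 2 ^+ j @[j --> \oo] --> 0 <->
  block_ideal w b A := dyadic_mean_cvg0 (mass_ge0 A).

Lemma block_ideal_sub_erdos_ulam : block_ideal w b `<=` erdos_ulam_ideal f.
Proof.
move=> A /massP; rewrite -cvg_shiftS => /(cvg_comp _ _ b_cvgny) mean0.
pose mean n := dyadic_mass w b A (b n).+1 / 2 ^+ (b n).+1.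
apply: (squeeze_cvg0 (v := fun n => 2 / c * mean n)); last first.
  by rewrite -[0](mulr0 (2 / c)); apply: cvgMr.
apply: filterS near_block_gt0 => n b0.
have cpow2_gt0 : 0 < c * 2 ^+ b n by rewrite mulr_gt0.
have total_ge := total_sum_dyadic_weight_ge b0.
have -> : 2 / c * mean n = dyadic_mass w b A (b n).+1 / (c * 2 ^+ b n).
  by rewrite /mean exprS mulf_div mulrCA -mulf_div divff ?mul1r.
rewrite (partial_density_ge0 f_gt0)/= ler_pM ?(partial_sum_ge0 f_gt0)//.
- by rewrite invr_ge0 total_sum_ge0.
- exact: partial_sum_dyadic_weight_le.
- by rewrite lef_pV2 ?posrE//; exact: lt_le_trans total_ge.
Qed.

Lemma erdos_ulam_sub_block_ideal : erdos_ulam_ideal f `<=` block_ideal w b.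
Proof.
have [L L_cvgny bL] := nondecreasing_adjoint b_homo b_cvgny.
have sumL A j : partial_sum f A (L j) = dyadic_mass w b A j.
  by apply: partial_sum_dyadic_weight; apply/seteqP; split=> x /=; rewrite bL.
move=> A /(cvg_comp _ _ L_cvgny) dens0; apply/massP.
apply: (squeeze_cvg0 (v := fun j => M * partial_density f A (L j))); last first.
  by rewrite -[0](mulr0 M); apply: cvgMr.
near=> j; have total_gt0 : 0 < dyadic_mass w b setT j.
  have j0 : (0 < j)%N by near: j; exact: nbhs_infty_gt.
  by rewrite -(prednK j0); apply: lt_le_trans (mass_ge _); rewrite mulr_gt0.
have massA_ge0 : 0 <= dyadic_mass w b A j by exact: dyadic_sum_ge0.
rewrite divr_ge0 ?(ltW (pow2_gt0 j))//= ler_pdivrMr// /partial_density.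
rewrite -partial_sumT !sumL mulrAC -[leLHS](divfK (lt0r_neq0 total_gt0)) mulrC.
by rewrite ler_wpM2r ?mass_le// divr_ge0// ltW.
Unshelve. all: by end_near. Qed.

Lemma block_ideal_dyadic_weight : block_ideal w b = erdos_ulam_ideal f.
Proof.
apply/seteqP; split.
- exact: block_ideal_sub_erdos_ulam.
- exact: erdos_ulam_sub_block_ideal.
Qed.

End erdos_ulam_blocks.

Lemma block_ideal_even_blocks_ge (R : realType) (w : nat -> R)
    (b : nat -> nat) (c M : R) :
  (forall x, 0 <= w x) -> b @ \oo --> \oo ->
  infinite_set [set n | c < block_mass w b n setT] ->
  (forall n, block_mass w b n setT <= M) ->
  exists b', [/\ b' @ \oo --> \oo, block_ideal w b' = block_ideal w b,
    forall k, c <= block_mass w b' k.*2 setT &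
    forall n, block_mass w b' n setT <= M].
Proof.
move=> w_ge0 b_cvgny /infinite_set_to_even[s s_inj s_even] mass_leM.
exists (s \o b); split.
- exact: cvg_comp b_cvgny (injective_cvgny s_inj).
- exact: block_ideal_reindex.
- by move=> k; have [n cn <-] := s_even k; rewrite block_mass_reindex// ltW.
- move=> n; have [[m _ ->//]|->] := block_mass_reindexP w b s_inj n setT.
  by apply: le_trans (mass_leM 0%N); exact: block_mass_ge0.
Qed.

Lemma block_ideal_isomorphic_erdos_ulam (R : realType) (w : nat -> R)
    (b : nat -> nat) (c M : R) :
  (forall x, 0 < w x) -> w x @[x --> \oo] --> 0 -> b @ \oo --> \oo ->
  0 < c -> (forall k, c <= block_mass w b k.*2 setT) ->
  (forall n, block_mass w b n setT <= M) ->
  exists2 f : nat -> R, erdos_ulam_fun f &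
    ideal_isomorphic (block_ideal w b) (erdos_ulam_ideal f).
Proof.
move=> w_gt0 w_cvg0 b_cvgny c_gt0 mass_gec mass_leM.
have [e e_bij be_homo] := nondecreasing_rearrangement b_cvgny.
have e_cvgny := injective_cvgny (bij_inj e_bij).
have we_gt0 x : 0 < (w \o e) x by exact: w_gt0.
have we_cvg0 : (w \o e) x @[x --> \oo] --> 0 by exact: cvg_comp e_cvgny w_cvg0.
have be_cvgny : b \o e @ \oo --> \oo by exact: cvg_comp e_cvgny b_cvgny.
have massE n : block_mass (w \o e) (b \o e) n setT = block_mass w b n setT.
  rewrite block_mass_permute//; case: e_bij => h _ hK.
  by congr block_mass; apply/seteqP; split=> // x _; exists (h x).
have mass_ge0 n : 0 <= block_mass w b n setT.
  by apply: block_mass_ge0 => x; exact: ltW.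
have sum_ge j : c / 4 * 2 ^+ j.+1 <= dyadic_mass (w \o e) (b \o e) setT j.+1.
  by apply: dyadic_sum_ge => k; rewrite massE.
have sum_le j : dyadic_mass (w \o e) (b \o e) setT j <= M * 2 ^+ j.
  apply: dyadic_sum_le => [|k]; last by rewrite massE.
  exact: le_trans (mass_ge0 0%N) (mass_leM 0%N).
have c4 : 0 < c / 4 by lra.
exists (dyadic_weight (w \o e) (b \o e)).
  exact: erdos_ulam_dyadic_weight be_homo be_cvgny c4 sum_ge.
rewrite -(block_ideal_dyadic_weight we_gt0 be_homo be_cvgny c4 sum_ge sum_le).
exact: block_ideal_permute.
Qed.

Theorem theorem5p19 (R : realType) (I : set (set nat))
    (densI : density_ideal R I) :
  nikodym R (I `|` dual_filter I) <->
  exists2 f : nat -> R, erdos_ulam_fun f & ideal_isomorphic I (erdos_ulam_ideal f).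
Proof.
split=> [nikI|[f EUf iso]]; last first.
  exact: ideal_isomorphic_nikodym iso (erdos_ulam_nikodym EUf).
have [w [b [w_gt0 b_cvgny IE]]] := density_ideal_block_ideal densI.
have [_ [_ _ IT]] := densI; rewrite {I densI}IE in nikI IT *.
have w_ge0 x : 0 <= w x by exact: ltW.
have [c c_gt0 infc] := proper_block_ideal_infinite w_ge0 IT.
have [M massM] := nikodym_block_mass_bounded w_ge0 b_cvgny IT nikI.
have w_cvg0 := nikodym_weight_cvg0 w_ge0 b_cvgny IT nikI.
have [b' [b'_cvgny <- mass_ge mass_le]] :=
  block_ideal_even_blocks_ge w_ge0 b_cvgny infc massM.
exact: block_ideal_isomorphic_erdos_ulam w_cvg0 b'_cvgny c_gt0 mass_ge mass_le.
Qed.
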